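(* Let $(\mathfrak{g},\phi_\mathfrak{g})$ be a LeibDer pair. If $H^2_{\mathrm{LeibDer}}(\mathfrak{g},\mathfrak{g})=0$, then $(\mathfrak{g},\phi_\mathfrak{g})$ is rigid.
   Context: All vector spaces and linear maps are over a field $\mathbb{K}$ of characteristic zero. A (right) Leibniz algebra is a vector space $\mathfrak{g}$ with a bilinear bracket satisfying $[[x,y],z]=[[x,z],y]+[x,[y,z]]$. A LeibDer pair $(\mathfrak{g},\phi_\mathfrak{g})$ is a Leibniz algebra with a derivation $\phi_\mathfrak{g}$ ($\phi_\mathfrak{g}[x,y]=[\phi_\mathfrak{g}(x),y]+[x,\phi_\mathfrak{g}(y)]$). Write $\mu(x,y)=[x,y]$. Cohomology with coefficients in itself: for $f\in\mathrm{Hom}(\mathfrak{g}^{\otimes n},\mathfrak{g})$, $$(\delta_Lf)(x_1,\ldots,x_{n+1})=[x_1,f(x_2,\ldots,x_{n+1})]+\sum_{i=2}^{n+1}(-1)^i[f(x_1,\ldots,\widehat{x_i},\ldots,x_{n+1}),x_i]+\sum_{i<j}(-1)^{j+1}f(x_1,\ldots,x_{i-1},[x_i,x_j],x_{i+1},\ldots,\widehat{x_j},\ldots,x_{n+1}),$$ $$\delta f=\sum_{i=1}^nf\circ(\mathrm{id}\otimes\cdots\otimes\phi_\mathfrak{g}\otimes\cdots\otimes\mathrm{id})-\phi_\mathfrak{g}\circ f\quad(\phi_\mathfrak{g}\text{ in the }i\text{-th place}).$$ Put $C^0_{\mathrm{LeibDer}}=0$, $C^1_{\mathrm{LeibDer}}(\mathfrak{g},\mathfrak{g})=\mathrm{Hom}(\mathfrak{g},\mathfrak{g})$,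 $C^n_{\mathrm{LeibDer}}(\mathfrak{g},\mathfrak{g})=\mathrm{Hom}(\mathfrak{g}^{\otimes n},\mathfrak{g})\times\mathrm{Hom}(\mathfrak{g}^{\otimes n-1},\mathfrak{g})$ for $n\ge2$, with $\partial f=(\delta_Lf,-\delta f)$ on $C^1_{\mathrm{LeibDer}}$ and $\partial(f_n,\overline f_n)=(\delta_Lf_n,\delta_L\overline f_n+(-1)^n\delta f_n)$ for $n\ge2$. $H^n_{\mathrm{LeibDer}}(\mathfrak{g},\mathfrak{g})$ is the $n$-th cohomology. A formal one-parameter deformation of $(\mathfrak{g},\phi_\mathfrak{g})$ is a pair of formal power series $\mu_t=\sum_{i\ge0}t^i\mu_i\in\mathrm{Hom}(\mathfrak{g}^{\otimes2},\mathfrak{g})[[t]]$, $\mu_0=\mu$, and $\phi_t=\sum_{i\ge0}t^i\phi_i\in\mathrm{Hom}(\mathfrak{g},\mathfrak{g})[[t]]$, $\phi_0=\phi_\mathfrak{g}$, such that $\mathfrak{g}[[t]]$ with the bracket $\mu_t$ is a Leibniz algebra over $\mathbb{K}[[t]]$ and $\phi_t$ is a derivation of it. Two deformations $(\mu_t,\phi_t)$, $(\mu'_t,\phi'_t)$ are equivalent if there is a formal isomorphism $\psi_t=\sum_{i\ge0}t^i\psi_i:\mathfrak{g}[[t]]\to\mathfrak{g}[[t]]$ with $\psi_i\in\mathrm{Hom}(\mathfrak{g},\mathfrak{g})$, $\psi_0=\mathrm{id}_\mathfrak{g}$, such that $\psi_t\circ\mu_t=\mu'_t\circ(\psi_t\otimes\psi_t)$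 and $\psi_t\circ\phi_t=\phi'_t\circ\psi_t$. A deformation is trivial if it is equivalent to the undeformed one $(\mu'_t=\mu,\phi'_t=\phi_\mathfrak{g})$. $(\mathfrak{g},\phi_\mathfrak{g})$ is rigid if every formal deformation of it is trivial. *)

(* Defs.v *)
From HB Require Import structures.
From mathcomp Require Import all_boot all_order all_algebra.
From mathcomp Require Import boolp functions.

Set Implicit Arguments.
Unset Strict Implicit.
Unset Printing Implicit Defensive.

Import GRing.Theory.
Local Open Scope ring_scope.

(* [pseries V] is V[[t]]; the series \sum_i t^i x_i is the function i |-> x_i.
   The alias keeps the Cauchy product below apart from the pointwise ring
   structure that MathComp-Analysis puts on functions. *)
Definition pseries (V : Type) : Type := nat -> V.

HB.instance Definition _ (V : zmodType) :=
  GRing.Zmodule.copy (pseries V) (nat -> V).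

Definition pseriesC (V : zmodType) (v : V) : pseries V :=
  fun n => if n is 0 then v else 0.

Lemma pseriesD (V : zmodType) (x y : pseries V) n : (x + y) n = x n + y n.
Proof. by []. Qed.

(* The two ways of summing over the triples (i, j, n - i - j). *)
Lemma sum_triangle (V : zmodType) (F : nat -> nat -> V) n :
  \sum_(i < n.+1) \sum_(j < (n - i).+1) F i j =
  \sum_(k < n.+1) \sum_(i < k.+1) F i (k - i)%N.
Proof.
elim: n => [|n IHn].
  by rewrite big_ord1 subn0 [RHS]big_ord1 !big_ord1.
rewrite big_ord_recr /= subnn big_ord1 /=.
under eq_bigr => i _ do rewrite subSn ?leq_ord // big_ord_recr /=.
rewrite big_split /= IHn [RHS]big_ord_recr /= -addrA; congr (_ + _).
rewrite [RHS]big_ord_recr /= subnn; congr (_ + _).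
by apply: eq_bigr => i _; rewrite subSn // leq_ord.
Qed.

Section PseriesModule.
Variables (R : comNzRingType) (V : lmodType R).
Implicit Types (a b : pseries R) (x y : pseries V).

Definition pseries_scale a x : pseries V :=
  fun n => \sum_(i < n.+1) a i *: x (n - i)%N.

Lemma pseries_scaleA a b x :
  pseries_scale a (pseries_scale b x) =
  pseries_scale (fun n => \sum_(i < n.+1) a i * b (n - i)%N) x.
Proof.
apply/funext => n; rewrite /pseries_scale.
under eq_bigr => i _ do rewrite scaler_sumr.
rewrite (sum_triangle (fun i j => a i *: (b j *: x (n - i - j)%N))).
apply: eq_bigr => k _; rewrite scaler_suml; apply: eq_bigr => i _.
by rewrite scalerA -subnDA subnKC // leq_ord.
Qed.

Lemma pseries_scale1 : left_id (pseriesC 1) pseries_scale.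
Proof.
move=> x; apply/funext => n; rewrite /pseries_scale big_ord_recl subn0 scale1r.
by rewrite big1 ?addr0 // => i _; rewrite scale0r.
Qed.

Lemma pseries_scaleDr : right_distributive pseries_scale +%R.
Proof.
move=> a x y; apply/funext => n; rewrite pseriesD /pseries_scale -big_split.
by apply: eq_bigr => i _; rewrite pseriesD scalerDr.
Qed.

Lemma pseries_scaleDl x : {morph pseries_scale^~ x : a b / a + b}.
Proof.
move=> a b; apply/funext => n; rewrite pseriesD /pseries_scale -big_split.
by apply: eq_bigr => i _; rewrite pseriesD scalerDl.
Qed.

End PseriesModule.

Section PseriesRing.
Variable R : comNzRingType.
Implicit Types a b : pseries R.

Definition pseries_mul a b : pseries R :=
  fun n => \sum_(i < n.+1) a i * b (n - i)%N.

Lemma pseries_mulA : associative pseries_mul.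
Proof. by move=> a b c; exact: (pseries_scaleA a b (c : pseries R^o)). Qed.

Lemma pseries_mulC : commutative pseries_mul.
Proof.
move=> a b; apply/funext => n; rewrite /pseries_mul (reindex_inj rev_ord_inj).
by apply: eq_bigr => i _ /=; rewrite subSS subKn ?leq_ord // mulrC.
Qed.

Lemma pseries_mul1 : left_id (pseriesC 1) pseries_mul.
Proof. by move=> a; exact: (pseries_scale1 (a : pseries R^o)). Qed.

Lemma pseries_mulDl : left_distributive pseries_mul +%R.
Proof. by move=> a b c; exact: (pseries_scaleDl (c : pseries R^o) a b). Qed.

Lemma pseries1_neq0 : pseriesC (1 : R) != 0.
Proof.
by apply/eqP => /(congr1 (@^~ 0)) /eqP; rewrite [_ == _]oner_eq0.
Qed.

HB.instance Definition _ := GRing.Zmodule_isComNzRing.Build (pseries R)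
  pseries_mulA pseries_mulC pseries_mul1 pseries_mulDl pseries1_neq0.

End PseriesRing.

HB.instance Definition _ (R : comNzRingType) (V : lmodType R) :=
  GRing.Zmodule_isLmodule.Build (pseries R) (pseries V)
    (@pseries_scaleA R V) (@pseries_scale1 R V)
    (@pseries_scaleDr R V) (@pseries_scaleDl R V).

Section LeibDer.
Variables (R : comNzRingType) (L : lmodType R).
Implicit Types (br : L -> L -> L) (phi : L -> L).

Record leibniz_algebra br : Prop := LeibnizAlgebra {
  leibniz_linearl : forall y, linear (br^~ y);
  leibniz_linearr : forall x, linear (br x);
  leibniz_identity : forall x y z,
    br (br x y) z = br (br x z) y + br x (br y z)
}.

Record derivation br phi : Prop := Derivation {
  derivation_linear : linear phi;
  derivation_leibniz : forall x y, phi (br x y) = br (phi x) y + br x (phi y)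
}.

Definition leibder_pair br phi : Prop :=
  leibniz_algebra br /\ derivation br phi.

End LeibDer.

Section Cohomology.
Variables (K : fieldType) (g : lmodType K) (br : g -> g -> g) (phi : g -> g).

Definition subst_arg n (i : 'I_n) (v : g) (x : (g ^ n)%type) : (g ^ n)%type :=
  [ffun k => if k == i then v else x k].

Definition omit_arg n (i : 'I_n.+1) (x : (g ^ n.+1)%type) : (g ^ n)%type :=
  [ffun k => x (lift i k)].

(* Hom(g^{\otimes n}, g) is the set of multilinear maps among all the maps
   g^n -> g. *)
Definition multilinear n (f : (g ^ n)%type -> g) : Prop :=
  forall (i : 'I_n) (x : (g ^ n)%type), linear (fun v => f (subst_arg i v x)).

(* Ordinals start at 0, so the i-th argument of the usual formula is the
   ordinal i - 1: this shifts the exponents of the signs by one. *)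
Definition leibniz_delta n (f : (g ^ n)%type -> g) : (g ^ n.+1)%type -> g :=
  fun x =>
    br (x ord0) (f (omit_arg ord0 x))
    + \sum_(i < n.+1 | (0 < i)%N)
        (-1) ^+ i.+1 *: br (f (omit_arg i x)) (x i)
    + \sum_(i < n.+1) \sum_(j < n.+1 | (i < j)%N)
        (-1) ^+ j.+2 *: f (omit_arg j (subst_arg i (br (x i) (x j)) x)).

Definition der_delta n (f : (g ^ n)%type -> g) : (g ^ n)%type -> g :=
  fun x => \sum_(i < n) f (subst_arg i (phi (x i)) x) - phi (f x).

(* Ambient spaces of the complex; the cochains are the elements satisfying
   [is_cochain]. *)
Definition cochain (n : nat) : lmodType K :=
  match n with
  | 0 => 'rV[K]_0
  | 1 => (g ^ 1)%type -> g
  | m.+2 => (((g ^ m.+2)%type -> g) * ((g ^ m.+1)%type -> g))%type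
  end.

Definition is_cochain (n : nat) : cochain n -> Prop :=
  match n with
  | 0 => fun=> True
  | 1 => fun f => multilinear f
  | m.+2 => fun c => multilinear c.1 /\ multilinear c.2
  end.

Definition leibder_d (n : nat) : cochain n -> cochain n.+1 :=
  match n return cochain n -> cochain n.+1 with
  | 0 => fun=> 0
  | 1 => fun f => (leibniz_delta f, - der_delta f)
  | m.+2 => fun c =>
      (leibniz_delta c.1, leibniz_delta c.2 + (-1) ^+ m.+2 *: der_delta c.1)
  end.

Definition leibder_cocycle (n : nat) (c : cochain n) : Prop :=
  is_cochain c /\ leibder_d c = 0.

Definition leibder_coboundary (n : nat) : cochain n -> Prop :=
  match n with
  | 0 => fun c => c = 0
  | m.+1 => fun c => exists2 b : cochain m, is_cochain b & leibder_d b = c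
  end.

(* H^n = Z^n / B^n is zero. *)
Definition leibder_cohomology_eq0 (n : nat) : Prop :=
  forall c : cochain n, leibder_cocycle c -> leibder_coboundary c.

End Cohomology.

Section Deformation.
Variables (K : fieldType) (g : lmodType K).
Implicit Types (mu : pseries (g -> g -> g)) (phi psi : pseries (g -> g)).

(* The K[[t]]-linear extension to g[[t]] of a series of linear maps, and the
   K[[t]]-bilinear extension of a series of bilinear maps. *)
Definition pseries_app phi (x : pseries g) : pseries g :=
  fun n => \sum_(i < n.+1) phi i (x (n - i)%N).

Definition pseries_app2 mu (x y : pseries g) : pseries g :=
  fun n => \sum_(i < n.+1) \sum_(j < (n - i).+1) mu i (x j) (y (n - i - j)%N).

Record formal_deformation (br : g -> g -> g) (phi0 : g -> g) mu phi : Prop :=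
  FormalDeformation {
    deformation_linearl : forall i y, linear ((mu i)^~ y);
    deformation_linearr : forall i x, linear (mu i x);
    deformation_linear : forall i, linear (phi i);
    deformation_br0 : mu 0%N = br;
    deformation_phi0 : phi 0%N = phi0;
    deformation_leibniz : leibniz_algebra (pseries_app2 mu);
    deformation_derivation : derivation (pseries_app2 mu) (pseries_app phi)
  }.

Record formal_isomorphism psi : Prop := FormalIsomorphism {
  formal_iso_linear : forall i, linear (psi i);
  formal_iso0 : psi 0%N = id;
  formal_iso_bij : bijective (pseries_app psi)
}.

Definition equivalent_deformations mu phi mu' phi' : Prop :=
  exists psi, [/\ formal_isomorphism psi,
    forall x y, pseries_app psi (pseries_app2 mu x y) =
                pseries_app2 mu' (pseries_app psi x) (pseries_app psi y)
  & forall x, pseries_app psi (pseries_app phi x) =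
              pseries_app phi' (pseries_app psi x)].

Definition trivial_deformation (br : g -> g -> g) (phi0 : g -> g) mu phi :=
  equivalent_deformations mu phi (pseriesC br) (pseriesC phi0).

Definition rigid (br : g -> g -> g) (phi0 : g -> g) : Prop :=
  forall mu phi, formal_deformation br phi0 mu phi ->
    trivial_deformation br phi0 mu phi.

End Deformation.

(* Main.v *)
Require Import Defs.
From mathcomp Require Import all_boot all_order all_algebra.
From mathcomp Require Import boolp functions.
Import GRing.Theory.
Local Open Scope ring_scope.

Set Implicit Arguments.
Unset Strict Implicit.
Unset Printing Implicit Defensive.

(** A deformation is trivialized by constructing psi_t one coefficient at a
    time.  For a series psi_t with psi_0 = id, the two defects
      A(x, y) = psi_t (mu_t (x, y)) - [psi_t x, psi_t y]   and
      D(x)    = psi_t (phi_t x) - phi (psi_t x)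
    measure how far psi_t is from intertwining (mu_t, phi_t) with the
    undeformed pair.  They are K[[t]]-linear in each argument, so that if they
    vanish below order n on the constants of g, they do so on all of g[[t]],
    and their coefficients of order n depend only on the constant terms of the
    arguments ([linear_lowest_order]).

    Applying psi_t to the Leibniz identity of mu_t and to the derivation
    property of phi_t, and using the same two identities for the constant
    structure on g[[t]], yields identities between the defects alone
    ([br_defect_leibniz], [phi_defect_leibniz]).  When the defects vanish below
    order n, the coefficient of order n of these identities says exactly that
    (A_n, D_n) is a 2-cocycle.  Since H^2 = 0 it is the coboundary of a linear
    map B ([lowest_defect_coboundary]), and replacing psi_t by psi_t + t^n B
    subtracts this coboundary from the defects of order n while leaving the
    lower orders alone ([intertwines_extend]).

    Correcting a single series additively, instead of composing infinitely many
    isomorphisms id + t^n B, avoids any discussion of convergence: the limit is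
    a definition by course-of-values recursion ([course_of_values_choice]).
    The same recursion inverts a series of maps whose constant term is the
    identity ([papp_bijective]). *)

(** * Course-of-values recursion with choice *)

Section Recursion.
Variables (T : Type) (P : nat -> (nat -> T) -> Prop).

Hypothesis P_local : forall n (f h : nat -> T),
  (forall i, (i <= n)%N -> f i = h i) -> P n f -> P n h.
Hypothesis P_extend : forall n (f : nat -> T), (forall m, (m < n)%N -> P m f) ->
  exists t, P n (fun i => if i == n then t else f i).

(** The n-th condition only sees the terms up to n, so a sequence can be built
    by choosing its terms in turn, each admissible after the earlier ones. *)
Lemma course_of_values_choice (t0 : T) : exists f, forall n, P n f.
Proof.
pose good n f := forall m, (m < n)%N -> P m f.
have step n (f : nat -> T) : exists t, good n f -> P n (fun i => if i == n then t else f i).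
  have [/P_extend[t Pt]|nf] := pselect (good n f); first by exists t.
  by exists t0 => /nf.
have [next nextP] := choice (fun nf => step nf.1 nf.2).
(* [F n] has its first n terms chosen; its other terms are junk. *)
pose F := fix F n : nat -> T := if n is m.+1
  then fun i => if i == m then next (m, F m) else F m i else fun=> t0.
have F_stable m n i : (i < m <= n)%N -> F n i = F m i.
  case/andP=> im; elim: n => [|n IHn]; first by rewrite leqn0 => /eqP->.
  rewrite leq_eqVlt => /predU1P[->//|mn] /=.
  by rewrite ltn_eqF ?IHn // (leq_trans im).
have F_good n : good n (F n).
  elim: n => [//|n IHn] m; rewrite ltnS leq_eqVlt => /predU1P[->|mn].
    exact: (nextP (n, F n)).
  apply: P_local (IHn m mn) => i im /=.
  by rewrite ltn_eqF // (leq_ltn_trans im).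
exists (fun n => F n.+1 n) => n.
apply: P_local (F_good n.+1 n (ltnSn n)) => i i_n.
by apply: F_stable; rewrite ltnSn ltnS.
Qed.

End Recursion.

(** * Linear maps as plain functions *)

(** [linear] is used as a property of unbundled functions, as in the definition
    of deformations. *)

Section LinearMaps.
Variable R : pzRingType.

Lemma linear_comp (U V W : lmodType R) (F : V -> W) (G : U -> V) :
  linear F -> linear G -> linear (fun x => F (G x)).
Proof. by move=> FP GP a x y; rewrite GP FP. Qed.

Lemma linear_add (U V : lmodType R) (F G : U -> V) :
  linear F -> linear G -> linear (fun x => F x + G x).
Proof. by move=> FP GP a x y; rewrite GP FP scalerDr addrACA. Qed.

Lemma linear_sub (U V : lmodType R) (F G : U -> V) :
  linear F -> linear G -> linear (fun x => F x - G x).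
Proof. by move=> FP GP a x y; rewrite GP FP scalerBr opprD addrACA. Qed.

Lemma linear_sum (U V : lmodType R) n (F : 'I_n -> U -> V) :
  (forall i, linear (F i)) -> linear (fun x => \sum_i F i x).
Proof.
move=> FP a x y; rewrite scaler_sumr -big_split.
by apply: eq_bigr => i _; rewrite FP.
Qed.

Lemma linear_fct (T : Type) (U V : lmodType R) (F : U -> T -> V) :
  (forall t, linear (F^~ t)) -> linear (F : U -> (T -> V)).
Proof. by move=> FP a x y; apply/funext => t; rewrite FP. Qed.

Variables (U V : lmodType R) (F : U -> V).
Hypothesis FP : linear F.

Lemma linear_map0 : F 0 = 0.
Proof. by have := FP (-1) 0 0; rewrite addr0 scaler0 scaleN1r addNr. Qed.

Lemma linear_mapD x y : F (x + y) = F x + F y.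
Proof. by rewrite -{1}[x]scale1r FP scale1r. Qed.

Lemma linear_mapZ a x : F (a *: x) = a *: F x.
Proof. by rewrite -[a *: x]addr0 FP linear_map0 addr0. Qed.

Lemma linear_map_sum n (a : 'I_n -> R) (x : 'I_n -> U) :
  F (\sum_i a i *: x i) = \sum_i a i *: F (x i).
Proof.
rewrite (big_morph F linear_mapD linear_map0).
by apply: eq_bigr => i _; exact: linear_mapZ.
Qed.

End LinearMaps.

(** * Power series *)

Section Series.
Variable K : fieldType.

Lemma pseriesZ (V : lmodType K) (a : pseries K) (x : pseries V) n :
  (a *: x) n = \sum_(i < n.+1) a i *: x (n - i)%N.
Proof. by []. Qed.

Definition pseriesX : pseries K := fun n => (n == 1%N)%:R.
Local Notation t := pseriesX.

Lemma pseriesXZ0 (V : lmodType K) (x : pseries V) : (t *: x) 0%N = 0.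
Proof. by rewrite [LHS]big_ord1 scale0r. Qed.

Lemma pseriesXZS (V : lmodType K) (x : pseries V) n : (t *: x) n.+1 = x n.
Proof.
rewrite [LHS]big_ord_recl scale0r add0r big_ord_recl scale1r subn1.
by rewrite big1 ?addr0 // => i _; rewrite scale0r.
Qed.

Lemma pseriesXnZ_lt (V : lmodType K) (x : pseries V) n m : (m < n)%N ->
  (t ^+ n *: x) m = 0.
Proof.
elim: n m => // n IHn [|m] mn; rewrite exprS -scalerA ?pseriesXZ0 //.
by rewrite pseriesXZS IHn.
Qed.

Lemma pseriesXnZ_eq (V : lmodType K) (x : pseries V) n : (t ^+ n *: x) n = x 0%N.
Proof.
by elim: n => [|n IHn]; rewrite ?expr0 ?scale1r // exprS -scalerA pseriesXZS.
Qed.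

Lemma pseriesCZ (V : lmodType K) a (x : pseries V) n : (pseriesC a *: x) n = a *: x n.
Proof.
rewrite [LHS]big_ord_recl subn0 big1 ?addr0 // => i _; exact: scale0r.
Qed.

Lemma pseriesC_linear (V : lmodType K) a (u v : V) :
  pseriesC (a *: u + v) = pseriesC a *: pseriesC u + pseriesC v.
Proof.
apply/funext=> n; rewrite pseriesD pseriesCZ.
by case: n => [|n] //=; rewrite scaler0 addr0.
Qed.

Definition pseries_tail (V : Type) (x : pseries V) : pseries V :=
  fun n => x n.+1.

Lemma pseries_split (V : lmodType K) (x : pseries V) :
  x = pseriesC (x 0%N) + t *: pseries_tail x.
Proof.
apply/funext=> -[|n]; rewrite pseriesD ?pseriesXZ0 ?addr0 //.
by rewrite pseriesXZS add0r.
Qed.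

(** A series is its constant term plus t times its tail, and a K[[t]]-linear
    map commutes with t; so the constants control each lowest coefficient. *)
Lemma linear_lowest_order (V W : lmodType K) (F : pseries V -> pseries W) n :
  linear F -> (forall u m, (m < n)%N -> F (pseriesC u) m = 0) ->
  (forall x m, (m < n)%N -> F x m = 0) /\
  (forall x, F x n = F (pseriesC (x 0%N)) n).
Proof.
move=> FP FC.
have FE x : F x = F (pseriesC (x 0%N)) + t *: F (pseries_tail x).
  by rewrite {1}[x]pseries_split linear_mapD // linear_mapZ.
have low x m : (m < n)%N -> F x m = 0.
  elim: m x => [|m IHm] x mn; rewrite FE pseriesD FC // add0r ?pseriesXZ0 //.
  by rewrite pseriesXZS IHm // ltnW.
split=> // x; rewrite {1}FE pseriesD; case: n low {FC} => [|n] low.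
  by rewrite pseriesXZ0 addr0.
by rewrite pseriesXZS (low (pseries_tail x)) ?addr0.
Qed.

Lemma linear_ext_const (V W : lmodType K) (F G : pseries V -> pseries W) :
  linear F -> linear G -> (forall u, F (pseriesC u) = G (pseriesC u)) -> F =1 G.
Proof.
move=> FP GP FG x; apply/funext => n; apply/eqP; rewrite -subr_eq0; apply/eqP.
have HP := linear_sub FP GP.
have [||low _] := @linear_lowest_order _ _ (fun x => F x - G x) n.+1 => //.
  by move=> u m _; rewrite FG subrr.
exact: (low x n).
Qed.

(** [pseries_app] with an arbitrary target.  With V -> W := g -> (g -> g) it
    partially applies a series of bilinear maps, which reduces [pseries_app2]
    to two successive applications ([papp2E]). *)
Definition papp (V W : zmodType) (f : pseries (V -> W)) (x : pseries V) :
  pseries W := fun n => \sum_(i < n.+1) f i (x (n - i)%N).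

Lemma papp_linearl (V W : lmodType K) (x : pseries V) :
  linear ((fun f => papp f x) : pseries (V -> W) -> pseries W).
Proof.
move=> a f h; apply/funext => n; rewrite pseriesD /papp.
under eq_bigr => i _ do rewrite pseriesD pseriesZ.
rewrite -[LHS]/(\sum_(i < n.+1) ((\sum_(j < i.+1) a j *: f (i - j)%N)
                                  (x (n - i)%N) + h i (x (n - i)%N))).
rewrite big_split; congr (_ + _).
under eq_bigr => i _ do rewrite fct_sumE.
rewrite pseriesZ.
under [RHS]eq_bigr => i _ do rewrite scaler_sumr.
rewrite (sum_triangle (fun i j => a i *: f j (x (n - i - j)%N))).
apply: eq_bigr => k _; apply: eq_bigr => i _.
by rewrite -subnDA subnKC // leq_ord.
Qed.

(** Both sides sum a_i f_j (x_k) over i + j + k = n, but the outer index is j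
    on the left and i on the right, hence the reversal of the inner sum. *)
Lemma papp_linearr (V W : lmodType K) (f : pseries (V -> W)) :
  (forall i, linear (f i)) -> linear (papp f).
Proof.
move=> fP a x y; apply/funext => n; rewrite pseriesD /papp.
under eq_bigr => i _ do rewrite pseriesD (linear_mapD (fP i)).
rewrite big_split; congr (_ + _).
rewrite pseriesZ.
under [RHS]eq_bigr => i _ do rewrite scaler_sumr.
rewrite (sum_triangle (fun i j => a i *: f j (x (n - i - j)%N))).
transitivity (\sum_(i < n.+1) \sum_(j < (n - i).+1) a j *: f i (x (n - i - j)%N)).
  by apply: eq_bigr => i _; rewrite pseriesZ (linear_map_sum (fP i)).
rewrite (sum_triangle (fun i j => a j *: f i (x (n - i - j)%N))).
apply: eq_bigr => k _; rewrite (reindex_inj rev_ord_inj).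
apply: eq_bigr => i _ /=; rewrite subSS subKn ?leq_ord //.
by rewrite -!subnDA subnKC ?subnK // leq_ord.
Qed.

Lemma papp_const (V W : zmodType) (f : pseries (V -> W)) (u : V) n :
  (forall i, f i 0 = 0) -> papp f (pseriesC u) n = f n u.
Proof.
move=> f0; rewrite /papp big_ord_recr /= subnn big1 ?add0r // => i _.
by case: (n - i)%N (subn_gt0 i n) => [|k]; rewrite ?ltn_ord.
Qed.

Lemma papp_lt (V W : zmodType) (f h : pseries (V -> W)) (x : pseries V) n :
  (forall i, (i <= n)%N -> f i = h i) -> papp f x n = papp h x n.
Proof.
by move=> fh; apply: eq_bigr => i _; rewrite fh // -ltnS.
Qed.

Lemma papp_injective (V : lmodType K) (f : pseries (V -> V)) :
  (forall i, linear (f i)) -> f 0%N = id -> injective (papp f).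
Proof.
move=> fP f0 x y fxy; apply/funext => n; elim/ltn_ind: n => n IHn.
have := congr1 (@^~ n) fxy; rewrite /papp !big_ord_recl /= subn0 f0.
rewrite (eq_bigr (fun i : 'I_n => f (bump 0 i) (y (n - bump 0 i)%N))).
  exact: addIr.
move=> i _; rewrite IHn // ltn_subrL (leq_ltn_trans _ (ltn_ord i)) //.
Qed.

(** As f_0 is the identity, the coefficient of order n of f(x) = y gives x_n in
    terms of the earlier coefficients of x. *)
Lemma papp_surjective (V : lmodType K) (f : pseries (V -> V)) y :
  f 0%N = id -> exists x, papp f x = y.
Proof.
move=> f0; pose P n (x : nat -> V) := papp f x n = y n.
have P_local n (x z : nat -> V) :
    (forall i, (i <= n)%N -> x i = z i) -> P n x -> P n z.
  by rewrite /P => xz <-; apply: eq_bigr => i _; rewrite xz ?leq_subr.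
have P_extend n (x : nat -> V) : (forall m, (m < n)%N -> P m x) ->
    exists u, P n (fun i => if i == n then u else x i).
  pose s := \sum_(i < n) f (bump 0 i) (x (n - bump 0 i)%N).
  move=> _; exists (y n - s).
  rewrite /P /papp big_ord_recl /= subn0 eqxx f0 -[RHS](subrK s).
  congr (_ + _); apply: eq_bigr => i _.
  by rewrite ltn_eqF // ltn_subrL (leq_ltn_trans _ (ltn_ord i)).
have [x xP] := course_of_values_choice P_local P_extend 0.
by exists x; apply/funext.
Qed.

Lemma papp_bijective (V : lmodType K) (f : pseries (V -> V)) :
  (forall i, linear (f i)) -> f 0%N = id -> bijective (papp f).
Proof.
move=> fP f0; have [h hK] := choice (fun y => papp_surjective y f0).
by exists h => // x; apply: (papp_injective fP f0).
Qed.

Lemma papp_at0 (V W : zmodType) (f : pseries (V -> W)) (x : pseries V) :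
  papp f x 0%N = f 0%N (x 0%N).
Proof. exact: big_ord1. Qed.

Lemma papp2E (g : lmodType K) (mu : pseries (g -> g -> g)) x y :
  pseries_app2 mu x y = papp (papp mu x) y.
Proof.
apply/funext => n; rewrite /papp.
under [RHS]eq_bigr => i _ do rewrite fct_sumE.
rewrite [LHS](sum_triangle (fun i j => mu i (x j) (y (n - i - j)%N))).
apply: eq_bigr => k _; apply: eq_bigr => i _.
by rewrite -subnDA subnKC // leq_ord.
Qed.

Section Bilinear.
Variables (g : lmodType K) (mu : pseries (g -> g -> g)).
Hypotheses (mul : forall i y, linear ((mu i)^~ y)).
Hypotheses (mur : forall i x, linear (mu i x)).

Lemma papp2_linearl y : linear ((pseries_app2 mu)^~ y).
Proof.
have muP i : linear (mu i) by apply: linear_fct => y'; exact: mul.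
move=> a x x'; rewrite !papp2E (papp_linearr muP).
exact: (papp_linearl y).
Qed.

Lemma papp2_linearr x : linear (pseries_app2 mu x).
Proof.
move=> a y y'; rewrite !papp2E; apply: papp_linearr => i b u v.
rewrite /papp !fct_sumE; move: b u v; apply: linear_sum => j; exact: mur.
Qed.

Lemma papp2_const u v n : pseries_app2 mu (pseriesC u) (pseriesC v) n = mu n u v.
Proof.
have muC i : papp mu (pseriesC u) i = mu i u.
  apply: papp_const => j; apply/funext=> w; exact: linear_map0 (mul j w).
by rewrite papp2E papp_const ?muC // => i; rewrite muC; exact: linear_map0.
Qed.

Lemma papp2_at0 x y : pseries_app2 mu x y 0%N = mu 0%N (x 0%N) (y 0%N).
Proof. by rewrite papp2E !papp_at0. Qed.

End Bilinear.

End Series.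

(** * The complex in low degrees *)

Section LowDegree.
Variables (K : fieldType) (g : lmodType K) (br : g -> g -> g) (phi : g -> g).

Definition args n (s : seq g) : (g ^ n)%type := [ffun i : 'I_n => s`_i].

(** Arguments are given as explicit lists so that the insertions and omissions
    of the differential are evaluated by computation. *)
Lemma argsE n (x : (g ^ n)%type) : exists2 s, size s = n & x = args n s.
Proof.
exists (codom x); first by rewrite size_codom card_ord.
apply/ffunP => i; rewrite ffunE (nth_map i) ?size_enum_ord //.
by congr (x _); apply: val_inj; rewrite /= nth_enum_ord.
Qed.

Lemma leibniz_delta1 (B : g -> g) u v :
  leibniz_delta br (fun x : (g ^ 1)%type => B (x ord0)) (args 2 [:: u; v]) =
  br u (B v) + br (B u) v - B (br u v).
Proof.
rewrite /leibniz_delta !big_mkcond /=.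
under [X in _ + X]eq_bigr => i _ do rewrite big_mkcond.
rewrite !big_ord_recl !big_ord0 !ffunE /=.
rewrite !exprS expr0 !mulN1r !opprK !scale1r !scaleN1r.
by rewrite !(add0r, addr0).
Qed.

Lemma leibniz_delta2 (F : g -> g -> g) u v w :
  leibniz_delta br (fun x : (g ^ 2)%type => F (x ord0) (x ord_max))
    (args 3 [:: u; v; w]) =
  br u (F v w) + br (F u w) v - br (F u v) w
  - F (br u v) w + F (br u w) v + F u (br v w).
Proof.
rewrite /leibniz_delta !big_mkcond /=.
under [X in _ + X]eq_bigr => i _ do rewrite big_mkcond.
rewrite !big_ord_recl !big_ord0 !ffunE /=.
rewrite !exprS expr0 !mulN1r !opprK !scale1r !scaleN1r.
by rewrite !(add0r, addr0) !addrA.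
Qed.

Lemma der_delta1 (B : g -> g) u :
  der_delta phi (fun x : (g ^ 1)%type => B (x ord0)) (args 1 [:: u]) =
  B (phi u) - phi (B u).
Proof. by rewrite /der_delta big_ord1 !ffunE. Qed.

Lemma der_delta2 (F : g -> g -> g) u v :
  der_delta phi (fun x : (g ^ 2)%type => F (x ord0) (x ord_max))
    (args 2 [:: u; v]) =
  F (phi u) v + F u (phi v) - phi (F u v).
Proof. by rewrite /der_delta !big_ord_recl big_ord0 addr0 !ffunE. Qed.

(** The last two hypotheses are the cocycle equations, arranged as the
    first-order variations of the Leibniz identity and of the derivation
    property. *)
Lemma cohomology2_eq0_solve (F : g -> g -> g) (D : g -> g) :
  leibder_cohomology_eq0 br phi 2 ->
  (forall v, linear (F^~ v)) -> (forall u, linear (F u)) -> linear D ->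
  (forall u v w, F (br u v) w + br (F u v) w =
     F (br u w) v + br (F u w) v + (F u (br v w) + br u (F v w))) ->
  (forall u v, D (br u v) + phi (F u v) =
     F (phi u) v + br (D u) v + (F u (phi v) + br u (D v))) ->
  exists B, [/\ linear B,
    forall u v, F u v = br u (B v) + br (B u) v - B (br u v)
  & forall u, D u = phi (B u) - B (phi u)].
Proof.
move=> H2 Fl Fr Dl FP DP.
pose F' := fun x : (g ^ 2)%type => F (x ord0) (x ord_max).
pose D' := fun x : (g ^ 1)%type => D (x ord0).
have cocycle : leibder_cocycle br phi ((F', D') : cochain g 2).
  split; first split.
  - case=> [[|[|//]] lt_i2] x a u v; rewrite /F' /= !ffunE /=; [exact: Fl|exact: Fr].
  - by move=> i x a u v; rewrite /D' (ord1 i) /= !ffunE /=; exact: Dl.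
  - congr pair; apply/funext=> x; have [s] := argsE x.
      case: s => [|u [|v [|w []]]] // _ ->; rewrite leibniz_delta2.
      rewrite [LHS](ACl ((5 * 2 * (6 * 1)) * (4 * 3))) /= -opprD.
      by rewrite -FP subrr.
    case: s => [|u [|v []]] // _ ->.
    rewrite -[LHS]/(leibniz_delta br D' (args 2 [:: u; v]) +
      (-1) ^+ 2 *: der_delta phi F' (args 2 [:: u; v])).
    rewrite leibniz_delta1 der_delta2 sqrrN expr1n scale1r !addrA.
    rewrite [LHS](ACl (4 * 2 * (5 * 1) * (3 * 6))) /= -opprD.
    by rewrite -DP subrr.
have [b bP [FE DE]] := H2 _ cocycle.
pose B u := b (args 1 [:: u]).
have bE : b = fun x => B (x ord0).
  apply/funext => x; congr (b _); apply/ffunP => i.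
  by rewrite ffunE ord1.
exists B; split.
- move=> a u v; have := bP ord0 0 a u v.
  have E w : subst_arg ord0 w (0 : (g ^ 1)%type) = args 1 [:: w].
    by apply/ffunP=> i; rewrite !ffunE ord1.
  by rewrite !E.
- move=> u v; have := congr1 (@^~ (args 2 [:: u; v])) FE.
  by rewrite bE leibniz_delta1 /F' !ffunE.
- move=> u; have := congr1 (@^~ (args 1 [:: u])) DE.
  rewrite bE -[LHS]/(- der_delta _ _ _) der_delta1 /D' ffunE opprB => <- //.
Qed.

End LowDegree.

(** * The constant structure on g[[t]] *)

(** Both defect identities below end with this cancellation: p and q are the
    terms without defect, and these match by the identities of the constant
    structure. *)
Lemma addr_cancel_common (V : zmodType) (a b a1 b1 a2 b2 p q : V) :
  a + (b + (p + q)) = a1 + (b1 + p) + (a2 + (b2 + q)) ->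
  a + b = a1 + b1 + (a2 + b2).
Proof.
rewrite !addrA => /eqP; rewrite [X in _ == X](ACl (1 * 2 * 4 * 5 * 3 * 6)) /=.
by move=> /eqP /addIr /addIr.
Qed.

Section ConstantStructure.
Variables (K : fieldType) (g : lmodType K) (br : g -> g -> g) (phi : g -> g).
Hypothesis gP : leibder_pair br phi.

Local Notation C := (@pseriesC g).
Local Notation BR := (pseries_app2 (pseriesC br)).
Local Notation PHI := (papp (pseriesC phi)).

Let brP : leibniz_algebra br. Proof. by case: gP. Qed.
Let phiP : derivation br phi. Proof. by case: gP. Qed.

Lemma br0l y : br 0 y = 0.
Proof. exact: linear_map0 (leibniz_linearl brP y). Qed.

Lemma br0r x : br x 0 = 0.
Proof. exact: linear_map0 (leibniz_linearr brP x). Qed.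

Lemma coef_br_linearl i y : linear ((pseriesC br i)^~ y).
Proof.
case: i => [|i]; first exact: leibniz_linearl brP y.
by move=> a u v; rewrite /= scaler0 addr0.
Qed.

Lemma coef_br_linearr i x : linear (pseriesC br i x).
Proof.
case: i => [|i]; first exact: leibniz_linearr brP x.
by move=> a u v; rewrite /= scaler0 addr0.
Qed.

Lemma coef_phi_linear i : linear (pseriesC phi i).
Proof.
case: i => [|i]; first exact: derivation_linear phiP.
by move=> a u v; rewrite /= scaler0 addr0.
Qed.

Lemma const_br_linearl y : linear (BR^~ y).
Proof. exact: papp2_linearl coef_br_linearl y. Qed.

Lemma const_br_linearr x : linear (BR x).
Proof. exact: papp2_linearr coef_br_linearr x. Qed.

Lemma const_phi_linear : linear PHI.
Proof. exact: papp_linearr coef_phi_linear. Qed.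

Lemma const_phiE x n : PHI x n = phi (x n).
Proof.
by rewrite [LHS]big_ord_recl subn0 big1 ?addr0.
Qed.

Lemma const_brE x y n : BR x y n = \sum_(j < n.+1) br (x j) (y (n - j)%N).
Proof.
rewrite [LHS]big_ord_recl /= subn0 [X in _ + X]big1 ?addr0 //.
by move=> i _; rewrite big1.
Qed.

Lemma const_br_C u v : BR (C u) (C v) = C (br u v).
Proof.
apply/funext => n; rewrite papp2_const.
- by case: n.
- exact: coef_br_linearl.
- exact: coef_br_linearr.
Qed.

Lemma const_phi_C u : PHI (C u) = C (phi u).
Proof.
apply/funext => n; rewrite const_phiE; case: n => //= n.
exact: linear_map0 (derivation_linear phiP).
Qed.

Lemma const_br_lowl x y n : (forall m, (m < n)%N -> x m = 0) ->
  BR x y n = br (x n) (y 0%N).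
Proof.
move=> x0; rewrite const_brE big_ord_recr /= subnn big1 ?add0r // => i _.
by rewrite x0 ?br0l.
Qed.

Lemma const_br_lowr x y n : (forall m, (m < n)%N -> y m = 0) ->
  BR x y n = br (x 0%N) (y n).
Proof.
move=> y0; rewrite const_brE big_ord_recl /= subn0 big1 ?addr0 // => i _.
by rewrite y0 ?br0r // ltn_subrL (leq_ltn_trans _ (ltn_ord i)).
Qed.

Lemma const_br_perturb x x' y y' n : (0 < n)%N ->
  BR (x + pseriesX K ^+ n *: x') (y + pseriesX K ^+ n *: y') n =
  BR x y n + (br (x 0%N) (y' 0%N) + br (x' 0%N) (y 0%N)).
Proof.
move=> n_gt0.
rewrite (linear_mapD (const_br_linearl _)) !(linear_mapD (const_br_linearr _)).
rewrite !(linear_mapZ (const_br_linearl _)) !(linear_mapZ (const_br_linearr _)).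
rewrite !pseriesD !pseriesXnZ_eq pseriesXnZ_lt // addr0 !papp2_at0.
by rewrite addrA.
Qed.

(** The identity is K[[t]]-linear in each argument, so it may be checked on
    constants, where it is the one of g. *)
Lemma const_br_leibniz x y z :
  BR (BR x y) z = BR (BR x z) y + BR x (BR y z).
Proof.
move: x; apply: linear_ext_const => [||u].
- exact: linear_comp (const_br_linearl _) (const_br_linearl _).
- apply: linear_add (const_br_linearl _).
  exact: linear_comp (const_br_linearl _) (const_br_linearl _).
move: y; apply: linear_ext_const => [||v].
- exact: linear_comp (const_br_linearl _) (const_br_linearr _).
- apply: linear_add (const_br_linearr _) _.
  exact: linear_comp (const_br_linearr _) (const_br_linearl _).
move: z; apply: linear_ext_const => [||w].
- exact: const_br_linearr.
- apply: linear_add.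
    exact: linear_comp (const_br_linearl _) (const_br_linearr _).
  exact: linear_comp (const_br_linearr _) (const_br_linearr _).
rewrite !const_br_C; apply/funext => -[|n].
  exact: leibniz_identity brP u v w.
by rewrite pseriesD /= addr0.
Qed.

Lemma const_phi_derivation x y :
  PHI (BR x y) = BR (PHI x) y + BR x (PHI y).
Proof.
move: x; apply: linear_ext_const => [||u].
- exact: linear_comp const_phi_linear (const_br_linearl _).
- apply: linear_add (const_br_linearl _).
  exact: linear_comp (const_br_linearl _) const_phi_linear.
move: y; apply: linear_ext_const => [||v].
- exact: linear_comp const_phi_linear (const_br_linearr _).
- apply: linear_add (const_br_linearr _) _.
  exact: linear_comp (const_br_linearr _) const_phi_linear.
rewrite !(const_br_C, const_phi_C); apply/funext => -[|n].
  exact: derivation_leibniz phiP u v.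
by rewrite pseriesD /= addr0.
Qed.

(** * Defects of an approximate trivialization *)

Section Defect.
Variables (mu : pseries (g -> g -> g)) (ph : pseries (g -> g)).
Hypothesis defP : formal_deformation br phi mu ph.

Local Notation MU := (pseries_app2 mu).
Local Notation PH := (papp ph).

Let muP : leibniz_algebra MU := deformation_leibniz defP.
Let phP : derivation MU PH := deformation_derivation defP.

Definition br_defect (psi : pseries (g -> g)) (x y : pseries g) : pseries g :=
  papp psi (MU x y) - BR (papp psi x) (papp psi y).

Definition phi_defect (psi : pseries (g -> g)) (x : pseries g) : pseries g :=
  papp psi (PH x) - PHI (papp psi x).

Definition intertwines_at n (psi : pseries (g -> g)) : Prop :=
  (forall u v, br_defect psi (C u) (C v) n = 0) /\
  (forall u, phi_defect psi (C u) n = 0).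

Lemma br_defect_local (f h : pseries (g -> g)) x y n :
  (forall i, (i <= n)%N -> f i = h i) -> br_defect f x y n = br_defect h x y n.
Proof.
move=> fh; have E z i : (i <= n)%N -> papp f z i = papp h z i.
  by move=> i_n; apply: papp_lt => j /leq_trans/(_ i_n); exact: fh.
congr (_ - _); first exact: E.
by rewrite !const_brE; apply: eq_bigr => i _; rewrite !E ?leq_subr // -ltnS.
Qed.

Lemma phi_defect_local (f h : pseries (g -> g)) x n :
  (forall i, (i <= n)%N -> f i = h i) -> phi_defect f x n = phi_defect h x n.
Proof.
by move=> fh; congr (_ - _); rewrite ?const_phiE (papp_lt _ fh).
Qed.

Lemma intertwines_local n (f h : pseries (g -> g)) :
  (forall i, (i <= n)%N -> f i = h i) -> intertwines_at n f -> intertwines_at n h.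
Proof.
move=> fh [fbr fphi]; split=> [u v|u].
  by rewrite -(br_defect_local _ _ fh).
by rewrite -(phi_defect_local _ fh).
Qed.

Lemma intertwines_at0 (psi : pseries (g -> g)) :
  psi 0%N = id -> intertwines_at 0 psi.
Proof.
move=> psi0; split=> [u v|u].
  rewrite -[LHS]/(_ 0%N - _ 0%N) papp2_at0 !papp_at0 papp2_at0 psi0.
  by rewrite (deformation_br0 defP) subrr.
rewrite -[LHS]/(_ 0%N - _ 0%N) const_phiE !papp_at0 psi0.
by rewrite (deformation_phi0 defP) subrr.
Qed.

Section LinearCoefficients.
Variable psi : pseries (g -> g).
Hypothesis psi_linear : forall i, linear (psi i).

Let pappP : linear (papp psi). Proof. exact: papp_linearr. Qed.

Lemma br_defect_linearl y : linear ((br_defect psi)^~ y).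
Proof.
apply: linear_sub; first exact: linear_comp pappP (leibniz_linearl muP y).
exact: linear_comp (const_br_linearl _) pappP.
Qed.

Lemma br_defect_linearr x : linear (br_defect psi x).
Proof.
apply: linear_sub; first exact: linear_comp pappP (leibniz_linearr muP x).
exact: linear_comp (const_br_linearr _) pappP.
Qed.

Lemma phi_defect_linear : linear (phi_defect psi).
Proof.
apply: linear_sub; first exact: linear_comp pappP (derivation_linear phP).
exact: linear_comp const_phi_linear pappP.
Qed.

Lemma papp_MU x y :
  papp psi (MU x y) = br_defect psi x y + BR (papp psi x) (papp psi y).
Proof. by rewrite subrK. Qed.

Lemma papp_PH x : papp psi (PH x) = phi_defect psi x + PHI (papp psi x).
Proof. by rewrite subrK. Qed.

(** Expand psi_t of the Leibniz identity of mu_t, moving psi_t inwards at the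
    cost of one defect for each bracket crossed. *)
Lemma br_defect_leibniz x y z :
  br_defect psi (MU x y) z + BR (br_defect psi x y) (papp psi z) =
  br_defect psi (MU x z) y + BR (br_defect psi x z) (papp psi y) +
  (br_defect psi x (MU y z) + BR (papp psi x) (br_defect psi y z)).
Proof.
have := congr1 (papp psi) (leibniz_identity muP x y z).
rewrite (linear_mapD pappP) !papp_MU.
rewrite (linear_mapD (const_br_linearl _) (br_defect psi x y)).
rewrite (linear_mapD (const_br_linearl _) (br_defect psi x z)).
rewrite (linear_mapD (const_br_linearr _) (br_defect psi y z)).
rewrite (const_br_leibniz (papp psi x) (papp psi y)).
exact: addr_cancel_common.
Qed.

(** The same expansion for psi_t (phi_t (mu_t (x, y))). *)
Lemma phi_defect_leibniz x y :
  phi_defect psi (MU x y) + PHI (br_defect psi x y) =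
  br_defect psi (PH x) y + BR (phi_defect psi x) (papp psi y) +
  (br_defect psi x (PH y) + BR (papp psi x) (phi_defect psi y)).
Proof.
have := congr1 (papp psi) (derivation_leibniz phP x y).
rewrite (linear_mapD pappP) papp_PH !papp_MU !papp_PH.
rewrite (linear_mapD (const_br_linearl _) (phi_defect psi x)).
rewrite (linear_mapD (const_br_linearr _) (phi_defect psi y)).
rewrite (linear_mapD const_phi_linear (br_defect psi x y)).
rewrite const_phi_derivation.
exact: addr_cancel_common.
Qed.

Variable n : nat.
Hypothesis psi_low : forall m, (m < n)%N -> intertwines_at m psi.

Lemma br_defect_low x y m : (m < n)%N -> br_defect psi x y m = 0.
Proof.
have [|low _] := @linear_lowest_order _ _ _ _ n (br_defect_linearl y).
  move=> u k kn.
  have [|low _] := @linear_lowest_order _ _ _ _ n (br_defect_linearr (C u)).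
    by move=> v l ln; exact: (psi_low ln).1.
  exact: low.
exact: low.
Qed.

Lemma br_defect_lowest x y :
  br_defect psi x y n = br_defect psi (C (x 0%N)) (C (y 0%N)) n.
Proof.
have [|_ ->] := @linear_lowest_order _ _ _ _ n (br_defect_linearl y).
  by move=> u m; exact: br_defect_low.
have [|_ ->//] :=
  @linear_lowest_order _ _ _ _ n (br_defect_linearr (C (x 0%N))).
by move=> u m; exact: br_defect_low.
Qed.

Lemma phi_defect_low x m : (m < n)%N -> phi_defect psi x m = 0.
Proof.
have [|low _] := @linear_lowest_order _ _ _ _ n phi_defect_linear.
  by move=> u k kn; exact: (psi_low kn).2.
exact: low.
Qed.

Lemma phi_defect_lowest x : phi_defect psi x n = phi_defect psi (C (x 0%N)) n.
Proof.
have [|_ ->] := @linear_lowest_order _ _ _ _ n phi_defect_linear => //.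
by move=> u m; exact: phi_defect_low.
Qed.

Hypothesis psi0 : psi 0%N = id.
Hypothesis H2 : leibder_cohomology_eq0 br phi 2.

(** In the coefficient of order n of the defect identities, every factor next
    to a defect contributes only its constant term, and there mu_t, phi_t and
    psi_t reduce to the bracket, phi and the identity.  What is left are the
    cocycle equations. *)
Lemma lowest_defect_coboundary : exists B : g -> g, [/\ linear B,
    forall u v, br_defect psi (C u) (C v) n =
                br u (B v) + br (B u) v - B (br u v)
  & forall u, phi_defect psi (C u) n = phi (B u) - B (phi u)].
Proof.
have mu0 u v : MU (C u) (C v) 0%N = br u v.
  by rewrite papp2_at0 (deformation_br0 defP).
have ph0 u : PH (C u) 0%N = phi u.
  by rewrite [LHS]papp_at0 (deformation_phi0 defP).
have psiC u : papp psi (C u) 0%N = u by rewrite papp_at0 psi0.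
apply: (cohomology2_eq0_solve (F := fun u v => br_defect psi (C u) (C v) n)
  (D := fun u => phi_defect psi (C u) n) H2).
- move=> v a u u'; rewrite pseriesC_linear (br_defect_linearl (C v)).
  by rewrite pseriesD pseriesCZ.
- move=> u a v v'; rewrite pseriesC_linear (br_defect_linearr (C u)).
  by rewrite pseriesD pseriesCZ.
- move=> a u v; rewrite pseriesC_linear phi_defect_linear.
  by rewrite pseriesD pseriesCZ.
- move=> u v w; have := congr1 (@^~ n) (br_defect_leibniz (C u) (C v) (C w)).
  have low := br_defect_low.
  rewrite !pseriesD !(const_br_lowl _ (low _ _)) (const_br_lowr _ (low _ _)).
  by rewrite !psiC !(br_defect_lowest (MU _ _)) (br_defect_lowest _ (MU _ _)) !mu0.
- move=> u v; have := congr1 (@^~ n) (phi_defect_leibniz (C u) (C v)).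
  have low := phi_defect_low.
  rewrite !pseriesD (const_br_lowl _ (low _)) (const_br_lowr _ (low _)) const_phiE.
  rewrite !psiC (br_defect_lowest (PH _)) (br_defect_lowest _ (PH _)).
  by rewrite phi_defect_lowest !ph0 mu0.
Qed.

(** The term t^n B changes psi_t (mu_t (u, v)) by B [u, v] and [psi_t u, psi_t v]
    by [B u, v] + [u, B v] at order n, so it removes the coboundary of B; the
    quadratic term has order 2n, beyond n as n > 0. *)
Lemma intertwines_extend : (0 < n)%N -> exists2 B : g -> g, linear B &
  intertwines_at n (psi + pseriesX K ^+ n *: (pseriesC B : pseries (g -> g))).
Proof.
move=> n_gt0; have [B [Bl FB DB]] := lowest_defect_coboundary.
exists B => //.
have pappE x : papp (psi + pseriesX K ^+ n *: (pseriesC B : pseries (g -> g))) x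
    = papp psi x + pseriesX K ^+ n *: papp (pseriesC B) x.
  rewrite (linear_mapD (papp_linearl x)) (linear_mapZ (papp_linearl x)) //.
have BE x : papp (pseriesC B) x 0%N = B (x 0%N) by rewrite papp_at0.
have psiC u : papp psi (C u) 0%N = u by rewrite papp_at0 psi0.
split=> [u v|u].
  rewrite /br_defect !pappE -[LHS]/(_ n - _ n) pseriesD const_br_perturb //.
  rewrite pseriesXnZ_eq !BE !psiC papp2_at0 (deformation_br0 defP) opprD addrACA.
  by rewrite -[X in X + _]/(br_defect psi (C u) (C v) n) FB subrKA subrr.
rewrite /phi_defect !pappE -[LHS]/(_ n - _ n) const_phiE !pseriesD !pseriesXnZ_eq.
rewrite !BE papp_at0 (deformation_phi0 defP) (linear_mapD (derivation_linear phiP)).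
rewrite opprD addrACA -const_phiE.
by rewrite -[X in X + _]/(phi_defect psi (C u) n) DB subrKA subrr.
Qed.

End LinearCoefficients.

Lemma trivializing_series : leibder_cohomology_eq0 br phi 2 ->
  exists psi : pseries (g -> g), [/\ forall i, linear (psi i), psi 0%N = id
    & forall n, intertwines_at n psi].
Proof.
move=> H2.
pose P n (psi : nat -> g -> g) := [/\ linear (psi n), (n = 0%N -> psi 0%N = id)
  & intertwines_at n psi].
have P_local n (f h : nat -> g -> g) :
    (forall i, (i <= n)%N -> f i = h i) -> P n f -> P n h.
  move=> fh [fl f0 fn]; split.
  - by rewrite -fh.
  - by rewrite -fh.
  - exact: intertwines_local fh fn.
have P_extend n (f : nat -> g -> g) : (forall m, (m < n)%N -> P m f) ->
    exists B, P n (fun i => if i == n then B else f i).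
  case: n => [_|n fP].
    exists id; split=> //; exact: intertwines_at0.
  (* Only the first n + 1 terms of f are known to be linear, and linearity of
     all of them is needed to extend the defects to g[[t]]. *)
  pose psi : pseries (g -> g) := fun i => if (i <= n)%N then f i else fun=> 0.
  have psi_linear i : linear (psi i).
    rewrite /psi; case: ifP => [i_n|_]; first by have [] := fP i i_n.
    by move=> a u v; rewrite scaler0 addr0.
  have psi0 : psi 0%N = id by rewrite /psi /=; have [_ ->] := fP 0%N isT.
  have psi_low m : (m < n.+1)%N -> intertwines_at m psi.
    move=> mn; have [_ _] := fP m mn; apply: intertwines_local => i im.
    by rewrite /psi (leq_trans im mn).
  have [B Bl Bn] := intertwines_extend psi_linear psi_low psi0 H2 isT.
  exists B; split; rewrite ?eqxx //.
  apply: intertwines_local Bn => i; rewrite leq_eqVlt pseriesD.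
  case/predU1P=> [->|i_n].
    by rewrite pseriesXnZ_eq /psi ltnn add0r eqxx.
  by rewrite pseriesXnZ_lt // addr0 /psi -ltnS i_n ltn_eqF.
have [psi psiP] := course_of_values_choice P_local P_extend id.
exists psi; split=> [i||n].
- by have [] := psiP i.
- by have [_ ->] := psiP 0%N.
- by have [] := psiP n.
Qed.

End Defect.

End ConstantStructure.

Theorem theorem5p7 (K : fieldType) (charK0 : [pchar K] =i pred0)
    (g : lmodType K) (br : g -> g -> g) (phi : g -> g)
    (gP : leibder_pair br phi) :
  leibder_cohomology_eq0 br phi 2 -> rigid br phi.
Proof.
move=> H2 mu ph defP.
have [psi [psi_linear psi0 psiP]] := trivializing_series gP defP H2.
exists psi; split.
- split=> //; exact: papp_bijective.
- move=> x y; apply/subr0_eq/funext => n.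
  exact: (br_defect_low gP defP psi_linear (fun m _ => psiP m) x y (ltnSn n)).
- move=> x; apply/subr0_eq/funext => n.
  exact: (phi_defect_low gP defP psi_linear (fun m _ => psiP m) x (ltnSn n)).
Qed.
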